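(* Let $a>1$ be fixed, let $u,v>0$, $M>0$ and $\alpha\in(0,1]$, and let $g\in Lip_M^{u,v}(\alpha)$. Then for every $m\in\mathbb{N}$ and every $x>0$, $$|\hat{\mathcal{R}}_{m,a}(g;x)-g(x)|\le M\left(\frac{\Lambda_{m,2}(x)}{ux^2+vx}\right)^{\alpha/2},$$ where $\Lambda_{m,2}(x)=\hat{\mathcal{R}}_{m,a}((t-x)^2;x)$.
   Context: For fixed $a>1$, $m\in\mathbb{N}=\{1,2,\dots\}$ and $x\ge 0$, the modified Szász-Mirakjan-Kantorovich operators are $$\hat{\mathcal{R}}_{m,a}(f;x)=m\sum_{k=0}^{\infty}s_{m,k}^a(x)\int_{k/m}^{(k+1)/m}f(t)\,dt,\qquad s_{m,k}^a(x)=a^{-x/(a^{1/m}-1)}\,\frac{x^k(\log a)^k}{(a^{1/m}-1)^k\,k!},$$ with $\log$ the natural logarithm (and $0^0=1$). In $\hat{\mathcal{R}}_{m,a}((t-x)^2;x)$ the operator acts on the function $t\mapsto (t-x)^2$; explicitly $$\Lambda_{m,2}(x)=\frac{1-3mx+3m^2x^2}{3m^2}-\frac{2(-1+a^{1/m})(-1+mx)\,x\log a}{(-1+a^{1/m})^2m^2}+\frac{x^2(\log a)^2}{(-1+a^{1/m})^2m^2}.$$ The two-parameter Lipschitz-type space is $$Lip_M^{u,v}(\alpha)=\left\{g\in C[0,\infty): |g(y)-g(x)|\le M\frac{|y-x|^\alpha}{(y+ux^2+vx)^{\alpha/2}}\ \text{for all } x,y\in[0,\infty)\text{ not both } 0\right\}.$$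 *)

(* Defs.v *)
From Stdlib Require Import Reals Factorial.
From Coquelicot Require Import Coquelicot.
Open Scope R_scope.

(* Real power for a nonnegative base and a positive exponent.  Stdlib's
   [Rpower 0 p] is 1, whereas 0^p = 0 is meant here. *)
Definition rpow (b p : R) : R :=
  if Req_EM_T b 0 then 0 else Rpower b p.

Definition szasz_weight (a : R) (m k : nat) (x : R) : R :=
  Rpower a (- x / (Rpower a (1 / INR m) - 1)) *
  ((x ^ k * ln a ^ k) / ((Rpower a (1 / INR m) - 1) ^ k * INR (fact k))).

Definition kantorovich (a : R) (m : nat) (f : R -> R) (x : R) : R :=
  INR m * Series (fun k : nat =>
    szasz_weight a m k x *
    RInt f (INR k / INR m) ((INR k + 1) / INR m)).

Definition Lambda2 (a : R) (m : nat) (x : R) : R :=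
  kantorovich a m (fun t => (t - x) ^ 2) x.

(* Functions on [0, +oo) are represented by total functions on [R]; their
   values at negative arguments are unconstrained. *)
Definition Lip (M u v alpha : R) (g : R -> R) : Prop :=
  continuous_on (fun x => 0 <= x) g /\
  forall x y : R, 0 <= x -> 0 <= y -> ~ (x = 0 /\ y = 0) ->
    Rabs (g y - g x) <=
      M * (rpow (Rabs (y - x)) alpha /
           rpow (y + u * x ^ 2 + v * x) (alpha / 2)).

(* Main.v *)
(** Write [p = alpha / 2] and [D = u x^2 + v x].  By concavity of [s |-> s^p],
    its graph lies below the tangent line at any [c > 0].  Hence membership in
    the Lipschitz class gives, for every [t >= 0],
    [|g t - g x| <= M (c/D)^p (1 + p ((t - x)^2 / c - 1))].
    The operator is positive and linear and fixes constants, so applying it to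
    this bound with [c = Lambda2 a m x] makes the correction term vanish.  This
    tangent line replaces the two Hölder inequalities of the usual argument. *)
Require Import Defs.
From Stdlib Require Import Reals Factorial Lra Lia.
From Coquelicot Require Import Coquelicot.
Open Scope R_scope.

(** * Real powers and the tangent-line inequality *)

Lemma rpow_pos_base (b p : R) : 0 < b -> rpow b p = Rpower b p.
Proof.
  intros Hb; unfold rpow; destruct (Req_EM_T b 0); [lra | reflexivity].
Qed.

Lemma rpow_0_base (p : R) : rpow 0 p = 0.
Proof.
  unfold rpow; destruct (Req_EM_T 0 0); [reflexivity | lra].
Qed.

Lemma rpow_nonneg (b p : R) : 0 <= rpow b p.
Proof.
  unfold rpow; destruct (Req_EM_T b 0); [lra | left; apply exp_pos].
Qed.

Lemma rpow_div (b d p : R) :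
  0 < b -> 0 < d -> rpow (b / d) p = rpow b p / rpow d p.
Proof.
  intros Hb Hd.
  rewrite !rpow_pos_base by (try apply Rdiv_lt_0_compat; lra).
  unfold Rpower; rewrite ln_div by assumption.
  replace (p * (ln b - ln d)) with (p * ln b + - (p * ln d)) by ring.
  now rewrite exp_plus, exp_Ropp.
Qed.

(** Turns the numerator $|t-x|^\alpha$ of the Lipschitz condition into a power of $(t-x)^2$, the
    function that the operator maps to [Lambda2]. *)
Lemma rpow_Rabs (y p : R) : rpow (Rabs y) p = rpow (y ^ 2) (p / 2).
Proof.
  destruct (Req_dec y 0) as [-> | Hy].
  - rewrite Rabs_R0; replace (0 ^ 2) with 0 by ring.
    now rewrite !rpow_0_base.
  - pose proof (Rabs_pos_lt y Hy) as Hp.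
    rewrite <- (pow2_abs y).
    rewrite !rpow_pos_base by (try apply pow_lt; assumption).
    unfold Rpower; rewrite ln_pow by assumption.
    f_equal; simpl INR; field.
Qed.

Lemma rpow_le_base (b d p : R) :
  0 < b -> b <= d -> 0 <= p -> rpow b p <= rpow d p.
Proof.
  intros Hb Hd Hp; rewrite !rpow_pos_base by lra.
  apply Rle_Rpower_l; lra.
Qed.

Lemma exp_weighted_am_gm (p y : R) :
  0 <= p <= 1 -> exp (p * y) <= 1 + p * (exp y - 1).
Proof.
  intros Hp.
  (* The tangent of [exp] at [p * y], evaluated at [y] and at [0]. *)
  assert (H1 : exp (p * y) * (1 + (1 - p) * y) <= exp y).
  { replace (exp y) with (exp (p * y) * exp ((1 - p) * y))
      by (rewrite <- exp_plus; f_equal; ring).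
    apply Rmult_le_compat_l; [left; apply exp_pos | apply exp_ineq1_le]. }
  assert (H2 : exp (p * y) * (1 + - (p * y)) <= 1).
  { replace 1 with (exp (p * y) * exp (- (p * y))) at 2
      by (rewrite <- exp_plus, Rplus_opp_r; apply exp_0).
    apply Rmult_le_compat_l; [left; apply exp_pos | apply exp_ineq1_le]. }
  (* With weights [p] and [1 - p] the terms carrying the factor [y] cancel, and the left sides add
     up to [exp (p * y)]. *)
  apply (Rmult_le_compat_l p) in H1; [| lra].
  apply (Rmult_le_compat_l (1 - p)) in H2; [| lra].
  lra.
Qed.

(** For [s > 0], factoring out [rpow c p] reduces the claim to [exp_weighted_am_gm] at
    [y = ln (s / c)]; for [s = 0] the second factor on the right is [1 - p]. *)
Lemma rpow_le_tangent (c s p : R) :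
  0 < c -> 0 <= s -> 0 <= p <= 1 ->
  rpow s p <= rpow c p * (1 + p * (s / c - 1)).
Proof.
  intros Hc [Hs | <-] Hp.
  - replace (rpow s p) with (rpow c p * rpow (s / c) p).
    + apply Rmult_le_compat_l; [apply rpow_nonneg |].
      assert (Hsc : 0 < s / c) by now apply Rdiv_lt_0_compat.
      rewrite rpow_pos_base by assumption.
      rewrite <- (exp_ln (s / c)) at 2 by assumption.
      now apply exp_weighted_am_gm.
    + rewrite rpow_div by assumption; field.
      rewrite rpow_pos_base by assumption; apply Rgt_not_eq, exp_pos.
  - rewrite rpow_0_base.
    apply Rmult_le_pos; [apply rpow_nonneg |].
    unfold Rdiv; lra.
Qed.

(** * Pointwise quadratic bound from the Lipschitz class *)

Lemma Lip_quadratic_bound (M u v alpha : R) (g : R -> R) (c x t : R) :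
  0 < u -> 0 < v -> 0 < M -> 0 < alpha <= 1 -> Lip M u v alpha g ->
  0 < c -> 0 < x -> 0 <= t ->
  Rabs (g t - g x) <=
    M * rpow (c / (u * x ^ 2 + v * x)) (alpha / 2) *
      (1 + alpha / 2 * ((t - x) ^ 2 / c - 1)).
Proof.
  intros Hu Hv HM Ha [_ Hg] Hc Hx Ht.
  assert (HD : 0 < u * x ^ 2 + v * x).
  { apply Rplus_lt_0_compat; repeat apply Rmult_lt_0_compat; simpl; lra. }
  set (D := u * x ^ 2 + v * x) in *.
  assert (Hpos : 0 < rpow D (alpha / 2)).
  { rewrite rpow_pos_base by assumption; apply exp_pos. }
  eapply Rle_trans; [apply Hg; lra |].
  rewrite Rmult_assoc; apply Rmult_le_compat_l; [lra |].
  rewrite rpow_Rabs, rpow_div by assumption.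
  replace (t + u * x ^ 2 + v * x) with (t + D) by (unfold D; ring).
  (* Since [t >= 0], lowering the base [t + D] of the denominator to [D] only enlarges the quotient,
     which then depends on [t] through [(t - x) ^ 2] alone. *)
  apply Rle_trans with (rpow ((t - x) ^ 2) (alpha / 2) / rpow D (alpha / 2)).
  - apply Rmult_le_compat_l; [apply rpow_nonneg |].
    apply Rinv_le_contravar; [assumption |].
    apply rpow_le_base; lra.
  - match goal with |- _ <= ?C / ?E * ?T =>
      replace (C / E * T) with (C * T / E) by (field; lra) end.
    apply Rmult_le_compat_r; [left; now apply Rinv_0_lt_compat |].
    apply rpow_le_tangent; [assumption | apply pow2_ge_0 | lra].
Qed.

(** * Integrals over one cell *)

Lemma continuous_on_nonneg_ex_RInt (g : R -> R) (b d : R) :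
  continuous_on (fun t => 0 <= t) g -> 0 <= b <= d -> ex_RInt g b d.
Proof.
  intros Hg Hbd.
  (* Values of [g] at negative arguments are arbitrary, so continuity at 0 is one-sided. Clamping
     the argument at 0 gives a function continuous on the whole line that agrees with [g] on the
     interval. *)
  apply ex_RInt_ext with (fun t => g (Rmax 0 t)).
  { intros t; rewrite Rmin_left by lra; intros Ht.
    now rewrite Rmax_right by lra. }
  apply (ex_RInt_continuous (V := R_CompleteNormedModule)); intros t _.
  apply filterlim_comp with
    (G := within (fun s => 0 <= s) (locally (Rmax 0 t)));
    [| apply Hg, Rmax_l].
  intros P [e He]; exists e; intros s Hs.
  apply He; [| apply Rmax_l].
  revert Hs; change (Rabs (s - t) < e -> Rabs (Rmax 0 s - Rmax 0 t) < e).
  unfold Rmax; destruct (Rle_dec 0 s), (Rle_dec 0 t);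
    unfold Rabs; repeat destruct Rcase_abs; lra.
Qed.

Lemma RInt_shifted_square (x b h : R) :
  is_RInt (fun t => (t - x) ^ 2) b (b + h)
    (h * ((b - x) ^ 2 + (b - x) * h + h ^ 2 / 3)).
Proof.
  replace (h * ((b - x) ^ 2 + (b - x) * h + h ^ 2 / 3))
    with (minus ((b + h - x) ^ 3 / 3) ((b - x) ^ 3 / 3))
    by (unfold minus, plus, opp; simpl; field).
  apply (is_RInt_derive (fun t => (t - x) ^ 3 / 3)).
  - intros t _; auto_derive; [trivial | field].
  - intros t _; apply (ex_derive_continuous (fun t => (t - x) ^ 2)).
    auto_derive; trivial.
Qed.

(** Carries the pointwise bound over to one cell of length [h]; [q] will be the shifted square. *)
Lemma RInt_dist_const_le (f q : R -> R) (f0 A B b h : R) :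
  0 <= h -> ex_RInt f b (b + h) -> ex_RInt q b (b + h) ->
  (forall t, b <= t <= b + h -> Rabs (f t - f0) <= A + B * q t) ->
  Rabs (RInt f b (b + h) - f0 * h) <= A * h + B * RInt q b (b + h).
Proof.
  intros Hh Hf Hq Hle.
  assert (Hc : forall r, is_RInt (fun _ => r) b (b + h) (r * h)).
  { intros r; replace (r * h) with (scal (b + h - b) r)
      by (unfold scal; simpl; unfold mult; simpl; ring).
    apply (is_RInt_const (V := R_NormedModule)). }
  apply (RInt_correct (V := R_CompleteNormedModule)) in Hf, Hq.
  apply (norm_RInt_le (V := R_NormedModule)
           (fun t => f t - f0) (fun t => A + B * q t) b (b + h)).
  - lra.
  - exact Hle.
  - apply (is_RInt_minus (V := R_NormedModule) f (fun _ => f0));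
      [assumption | apply Hc].
  - apply (is_RInt_plus (V := R_NormedModule) (fun _ => A));
      [apply Hc |].
    now apply (is_RInt_scal (V := R_NormedModule) q).
Qed.

(** * Series and the Poisson form of the weights *)

Lemma INR_le_pow2 (k : nat) : INR k <= 2 ^ k.
Proof.
  induction k as [| k IH]; [simpl; lra |].
  rewrite S_INR; simpl.
  assert (1 <= 2 ^ k) by (apply pow_R1_Rle; lra); lra.
Qed.

Lemma is_series_exp (y : R) :
  is_series (fun k => y ^ k / INR (fact k)) (exp y).
Proof.
  apply is_series_ext with (2 := is_exp_Reals y); intros k.
  now rewrite pow_n_pow.
Qed.

(** The mean of the Poisson distribution whose probabilities are the Szász weights. *)
Definition szasz_rate (a : R) (m : nat) (x : R) : R :=
  x * ln a / (Rpower a (1 / INR m) - 1).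

Section Weights.

Context (a : R) (ha : 1 < a) (m : nat) (hm : (1 <= m)%nat) (x : R) (hx : 0 < x).

Let hm_pos : 0 < INR m.
Proof. apply lt_0_INR; lia. Qed.

Let root_gt_1 : 1 < Rpower a (1 / INR m).
Proof.
  rewrite <- (Rpower_O a) at 1 by lra.
  apply Rpower_lt; [lra | apply Rdiv_lt_0_compat; lra].
Qed.

Lemma szasz_weight_poisson (k : nat) :
  szasz_weight a m k x =
    exp (- szasz_rate a m x) * (szasz_rate a m x ^ k / INR (fact k)).
Proof.
  unfold szasz_weight.
  set (r := Rpower a (1 / INR m)) in *.
  replace (Rpower a (- x / (r - 1))) with (exp (- szasz_rate a m x)).
  2: { unfold Rpower, szasz_rate; f_equal; fold r; field; lra. }
  f_equal; unfold szasz_rate; fold r.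
  unfold Rdiv at 2 3; rewrite !Rpow_mult_distr, pow_inv.
  field; split; [apply INR_fact_neq_0 | apply pow_nonzero; lra].
Qed.

Lemma szasz_rate_pos : 0 < szasz_rate a m x.
Proof.
  apply Rdiv_lt_0_compat; [| lra].
  apply Rmult_lt_0_compat; [assumption |].
  rewrite <- ln_1; apply ln_increasing; lra.
Qed.

Lemma szasz_weight_pos (k : nat) : 0 < szasz_weight a m k x.
Proof.
  rewrite szasz_weight_poisson.
  apply Rmult_lt_0_compat; [apply exp_pos |].
  apply Rdiv_lt_0_compat; [apply pow_lt, szasz_rate_pos | apply INR_fact_lt_0].
Qed.

(** Total mass one is what makes the operator fix constants. *)
Lemma is_series_szasz_weight :
  is_series (fun k => szasz_weight a m k x) 1.
Proof.
  replace 1 with (exp (- szasz_rate a m x) * exp (szasz_rate a m x))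
    by (rewrite <- exp_plus, Rplus_opp_l; apply exp_0).
  eapply is_series_ext; [intros k; symmetry; apply szasz_weight_poisson |].
  apply (is_series_scal_l (K := R_AbsRing) (V := R_NormedModule)), is_series_exp.
Qed.

(** The factor [b ^ k] is absorbed into the power of the rate, which leaves an exponential
    series. *)
Lemma ex_series_szasz_weight_geom (b : R) :
  ex_series (fun k => szasz_weight a m k x * b ^ k).
Proof.
  apply ex_series_ext with (fun k => exp (- szasz_rate a m x) *
    ((szasz_rate a m x * b) ^ k / INR (fact k))).
  - intros k; rewrite szasz_weight_poisson, Rpow_mult_distr.
    unfold Rdiv; simpl; ring.
  - apply (ex_series_scal_l (K := R_AbsRing) (V := R_NormedModule)).
    eexists; apply is_series_exp.
Qed.

(** * The second moment: convergence and positivity *)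

Let cell_right (k : nat) : (INR k + 1) / INR m = INR k / INR m + / INR m.
Proof. field; lra. Qed.

Let h_pos : 0 < / INR m.
Proof. now apply Rinv_0_lt_compat. Qed.

Let sq (t : R) : R := (t - x) ^ 2.

Let cell (f : R -> R) (k : nat) : R :=
  RInt f (INR k / INR m) ((INR k + 1) / INR m).

Let cell_sq (k : nat) :
  cell sq k = / INR m * ((INR k / INR m - x) ^ 2
                + (INR k / INR m - x) * / INR m + (/ INR m) ^ 2 / 3).
Proof.
  unfold cell; rewrite cell_right; apply is_RInt_unique, RInt_shifted_square.
Qed.

(** Completing the square: $y^2+yh+h^2/3=(y+h/2)^2+h^2/12$. The bound is uniform in [k]. *)
Let cell_sq_lower (k : nat) : (/ INR m) ^ 3 / 12 <= cell sq k.
Proof.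
  rewrite cell_sq; set (h := / INR m) in *; set (y := INR k / INR m - x).
  replace (h ^ 3 / 12) with (h * (h ^ 2 / 12)) by field.
  apply Rmult_le_compat_l; [lra |].
  assert (0 <= (y + h / 2) ^ 2) by apply pow2_ge_0; lra.
Qed.

(** The cell integral grows quadratically in [k], so a multiple of [4 ^ k] dominates it. *)
Lemma ex_series_szasz_second_moment :
  ex_series (fun k => szasz_weight a m k x * cell sq k).
Proof.
  set (h := / INR m) in *.
  apply (ex_series_le (K := R_AbsRing) (V := R_CompleteNormedModule)) with
    (b := fun k => h * (4 * h ^ 2 + 2 * x ^ 2) * (szasz_weight a m k x * 4 ^ k)).
  2: { apply (ex_series_scal_l (K := R_AbsRing) (V := R_NormedModule)), ex_series_szasz_weight_geom. }
  intros k.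
  change (Rabs (szasz_weight a m k x * cell sq k) <=
            h * (4 * h ^ 2 + 2 * x ^ 2) * (szasz_weight a m k x * 4 ^ k)).
  assert (Hw := szasz_weight_pos k).
  assert (Hlow : 0 < cell sq k).
  { eapply Rlt_le_trans; [| apply cell_sq_lower].
    apply Rdiv_lt_0_compat; [now apply pow_lt | lra]. }
  rewrite Rabs_pos_eq by (apply Rmult_le_pos; lra).
  replace (h * (4 * h ^ 2 + 2 * x ^ 2) * (szasz_weight a m k x * 4 ^ k))
    with (szasz_weight a m k x * (h * ((4 * h ^ 2 + 2 * x ^ 2) * 4 ^ k))) by ring.
  apply Rmult_le_compat_l; [lra |].
  rewrite cell_sq; fold h; apply Rmult_le_compat_l; [lra |].
  unfold Rdiv at 1 2; fold h.
  assert (H0 := pos_INR k); assert (H2 := INR_le_pow2 k).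
  assert (H1 : 1 <= 2 ^ k) by (apply pow_R1_Rle; lra).
  (* As $k\le 2^k$ and $1\le 2^k$, this product bounds $k^2$, $k$ and 1 at once. *)
  replace (4 ^ k) with (2 ^ k * 2 ^ k)
    by (rewrite <- Rpow_mult_distr; f_equal; ring).
  set (n := INR k) in *; set (e := 2 ^ k) in *.
  assert (He : n ^ 2 <= e * e) by nra.
  assert (Hn : n <= e * e) by nra.
  assert (H1e : 1 <= e * e) by nra.
  assert (Hh2 : 0 <= h ^ 2) by apply pow2_ge_0.
  assert (Hx2 : 0 <= x ^ 2) by apply pow2_ge_0.
  (* The mixed term is removed by $(nh-x)^2=2n^2h^2+2x^2-(nh+x)^2$. *)
  apply Rle_trans with (2 * (n ^ 2 * h ^ 2) + 2 * x ^ 2 + n * h ^ 2 + h ^ 2).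
  - assert (0 <= (n * h + x) ^ 2) by apply pow2_ge_0.
    assert (0 <= x * h) by (apply Rmult_le_pos; lra).
    lra.
  - apply (Rmult_le_compat_r (h ^ 2)) in He; [| assumption].
    apply (Rmult_le_compat_r (h ^ 2)) in Hn; [| assumption].
    assert (h ^ 2 <= e * e * h ^ 2) by nra.
    assert (x ^ 2 <= e * e * x ^ 2) by nra.
    lra.
Qed.

(** The uniform lower bound on cells and total mass one give at least $1/(12m^2)$. Positivity allows
    [Lambda2] to serve as the tangent point [c]. *)
Lemma Lambda2_pos : 0 < Lambda2 a m x.
Proof.
  unfold Lambda2, kantorovich.
  apply Rmult_lt_0_compat; [assumption |].
  apply Rlt_le_trans with (Series (fun k => (/ INR m) ^ 3 / 12 * szasz_weight a m k x)).
  - rewrite Series_scal_l, (is_series_unique _ _ is_series_szasz_weight).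
    rewrite Rmult_1_r; apply Rdiv_lt_0_compat; [now apply pow_lt | lra].
  - apply Series_le; [| exact ex_series_szasz_second_moment].
    intros k; assert (Hw := szasz_weight_pos k); split.
    + apply Rmult_le_pos; [| lra].
      apply Rlt_le, Rdiv_lt_0_compat; [now apply pow_lt | lra].
    + rewrite Rmult_comm; apply Rmult_le_compat_l; [lra | apply cell_sq_lower].
Qed.

(** * Transfer of a quadratic bound to the operator *)

Lemma kantorovich_quadratic_bound (g : R -> R) (g0 A B : R) :
  continuous_on (fun t => 0 <= t) g ->
  (forall t, 0 <= t -> Rabs (g t - g0) <= A + B * (t - x) ^ 2) ->
  Rabs (kantorovich a m g x - g0) <= A + B * Lambda2 a m x.
Proof.
  intros Hcont Hle.
  set (w := fun k => szasz_weight a m k x).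
  (* Cells have length [/ INR m], so [d k] is the weighted cell integral of [g - g0], and [e k] that
     of its quadratic majorant. *)
  set (d := fun k => w k * (cell g k - g0 * / INR m)).
  set (e := fun k => w k * (A * / INR m + B * cell sq k)).
  assert (He : is_series e ((A + B * Lambda2 a m x) * / INR m)).
  { replace ((A + B * Lambda2 a m x) * / INR m) with
      (A * / INR m * 1 + B * Series (fun k => w k * cell sq k))
      by (unfold Lambda2, kantorovich, w, cell, sq; field; lra).
    apply is_series_ext with
      (fun k => A * / INR m * w k + B * (w k * cell sq k)).
    { intros k; unfold e; simpl; ring. }
    apply (is_series_plus (K := R_AbsRing) (V := R_NormedModule)).
    - apply (is_series_scal_l (K := R_AbsRing) (V := R_NormedModule)), is_series_szasz_weight.
    - apply (is_series_scal_l (K := R_AbsRing) (V := R_NormedModule)).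
      apply Series_correct, ex_series_szasz_second_moment. }
  assert (Hde : forall k, Rabs (d k) <= e k).
  { intros k; unfold d, e.
    assert (Hw : 0 < w k) by apply szasz_weight_pos.
    rewrite Rabs_mult, (Rabs_pos_eq (w k)) by lra.
    apply Rmult_le_compat_l; [lra |].
    assert (Hk : 0 <= INR k / INR m).
    { apply Rmult_le_pos; [apply pos_INR | lra]. }
    unfold cell; rewrite cell_right.
    apply RInt_dist_const_le.
    - lra.
    - apply continuous_on_nonneg_ex_RInt; [assumption | lra].
    - eexists; apply RInt_shifted_square.
    - intros t Ht; apply Hle; lra. }
  (* Domination by [e] yields the convergence needed to split the series of [g] into that of [d] and
     a constant part. *)
  assert (Habs : ex_series (fun k => Rabs (d k))).
  { apply (ex_series_le (K := R_AbsRing) (V := R_CompleteNormedModule)) with e.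
    - intros k; change (Rabs (Rabs (d k)) <= e k).
      rewrite Rabs_Rabsolu; apply Hde.
    - eexists; exact He. }
  assert (Hg : kantorovich a m g x - g0 = INR m * Series d).
  { assert (Hs : Series (fun k => w k * cell g k) = Series d + g0 * / INR m * 1).
    { apply is_series_unique.
      apply is_series_ext with (fun k => d k + g0 * / INR m * w k).
      { intros k; unfold d; simpl; ring. }
      apply (is_series_plus (K := R_AbsRing) (V := R_NormedModule)).
      - apply Series_correct, ex_series_Rabs, Habs.
      - apply (is_series_scal_l (K := R_AbsRing) (V := R_NormedModule)), is_series_szasz_weight. }
    unfold kantorovich.
    change (INR m * Series (fun k => w k * cell g k) - g0 = INR m * Series d).
    rewrite Hs; field; lra. }
  rewrite Hg, Rabs_mult, (Rabs_pos_eq (INR m)) by lra.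
  replace (A + B * Lambda2 a m x) with
    (INR m * ((A + B * Lambda2 a m x) * / INR m)) by (field; lra).
  apply Rmult_le_compat_l; [lra |].
  rewrite <- (is_series_unique _ _ He).
  eapply Rle_trans; [apply Series_Rabs, Habs |].
  apply Series_le; [| eexists; exact He].
  intros k; split; [apply Rabs_pos | apply Hde].
Qed.

End Weights.

Theorem theorem2p3 (a : R) (ha : 1 < a)
  (u v M alpha : R) (hu : 0 < u) (hv : 0 < v) (hM : 0 < M)
  (halpha : 0 < alpha <= 1)
  (g : R -> R) (hg : Lip M u v alpha g)
  (m : nat) (hm : (1 <= m)%nat) (x : R) (hx : 0 < x) :
  Rabs (kantorovich a m g x - g x) <=
    M * rpow (Lambda2 a m x / (u * x ^ 2 + v * x)) (alpha / 2).
Proof.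
  assert (Hc := Lambda2_pos a ha m hm x hx).
  set (c := Lambda2 a m x) in *.
  set (K := M * rpow (c / (u * x ^ 2 + v * x)) (alpha / 2)).
  (* The form [A + B * Lambda2 a m x], with [A] and [B] read off from the tangent bound as
     coefficients of 1 and [(t - x) ^ 2]. *)
  replace K with (K * (1 - alpha / 2) + K * (alpha / 2) / c * c) by (field; lra).
  apply kantorovich_quadratic_bound; try assumption.
  - apply hg.
  - intros t Ht.
    eapply Rle_trans; [now apply (Lip_quadratic_bound M u v alpha g c) |].
    fold K; right; field; lra.
Qed.
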